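(* Let $G$ be a finite graph and let $Y_G$ be its affine graph hypersurface complement. In the Grothendieck ring $K(\mathrm{Var})$, modulo the ideal $(\mathbb{L})$ generated by $\mathbb{L}=[\mathbb{A}^1]$, $$[Y_G]\equiv\begin{cases}0 \mod (\mathbb{L}) & \text{if } G \text{ has edges that are not looping edges},\\ (-1)^n \mod (\mathbb{L}) & \text{if } G \text{ has } n\ge 0 \text{ looping edges, and no other edge.}\end{cases}$$
   Context: Graphs are finite; looping edges and multiple edges are allowed, and graphs need not be connected. For a connected graph $G$ with edges $e_1,\dots,e_n$ and corresponding variables $t_1,\dots,t_n$, the graph polynomial is $\psi_G(t_1,\dots,t_n)=\sum_{T\subseteq G}\prod_{e\notin T}t_e$, where $T$ runs over the spanning trees of $G$ and $t_e$ is the variable of the edge $e$. For a general finite graph, $\psi_G$ is the product of the graph polynomials of its connected components. Let $\widehat X_G\subset\mathbb{A}^n$ be the affine hypersurface $\{\psi_G=0\}$ and $Y_G=\mathbb{A}^n\smallsetminus\widehat X_G$ the affine graph hypersurface complement (for a graph with no edges, $Y_G=\mathbb{A}^0$). $K(\mathrm{Var})$ is the Grothendieck ring of varieties over $\mathbb{Q}$: it is generated by isomorphism classes of quasi-projective varieties, with relations $[X]=[X\smallsetminus Y]+[Y]$ for closed embeddings $Y\subseteq X$ and product $[X]\cdot[Y]=[X\times Y]$. *)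

(* Defs.v *)
From HB Require Import structures.
From mathcomp Require Import all_boot all_order all_algebra all_field.
From mathcomp Require Import boolp.
From mathcomp Require Import mpoly.

Set Implicit Arguments.
Unset Strict Implicit.
Unset Printing Implicit Defensive.

Import GRing.Theory.
Local Open Scope ring_scope.
Local Open Scope quotient_scope.

(** * Quasi-projective varieties over Q

    A quasi-projective variety over Q (reduced, not necessarily irreducible) is
    given by its geometric points: a locally closed subset of P^(N-1)(Qbar)
    cut out by homogeneous polynomials with rational coefficients, where Qbar is
    [algC]. Points of P^(N-1) are the nonzero vectors of Qbar^N up to
    proportionality; a subset is given by the cone of its representatives.
    As Q is perfect, these are the reduced quasi-projective schemes over Q. *)

Definition ev N (p : {mpoly rat[N]}) (x : 'rV[algC]_N) : algC :=
  mmap ratr (x 0) p.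

Definition same_point N (x y : 'rV[algC]_N) :=
  exists2 c : algC, c != 0 & y = c *: x.

Definition homogeneous N (F : seq {mpoly rat[N]}) :=
  forall p, p \in F -> p \is homog mdeg.

Definition vanish N (F : seq {mpoly rat[N]}) (x : 'rV[algC]_N) :=
  forall p, p \in F -> ev p x = 0.

Definition locally_closed N (A : 'rV[algC]_N -> Prop) :=
  exists F H : seq {mpoly rat[N]},
    [/\ homogeneous F, homogeneous H &
        forall x, A x <-> [/\ x != 0, vanish F x & ~ vanish H x]].

Record qpvar N := QPVar {
  points :> 'rV[algC]_N -> Prop;
  points_locally_closed : locally_closed points }.

(** A map is given on representatives; it is a morphism over Q if near each
    point it is given by forms of a common degree with rational coefficients. *)
Definition morphism N M (X : qpvar N) (Y : qpvar M)
    (f : 'rV[algC]_N -> 'rV[algC]_M) :=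
  forall x, X x ->
    Y (f x) /\
    exists (d : nat) (h : 'I_M -> {mpoly rat[N]}),
      [/\ forall j, h j \is d.-homog,
          \row_j ev (h j) x != 0 &
          forall y, X y -> \row_j ev (h j) y != 0 ->
            same_point (f y) (\row_j ev (h j) y)].

Definition isomorphic N M (X : qpvar N) (Y : qpvar M) :=
  exists f g, [/\ morphism X Y f, morphism Y X g,
    forall x, X x -> same_point (g (f x)) x &
    forall y, Y y -> same_point (f (g y)) y].

(** Up to isomorphism, every closed embedding is of this form. *)
Definition closed_in N (Y X : qpvar N) :=
  exists2 F : seq {mpoly rat[N]}, homogeneous F &
    forall x, Y x <-> X x /\ vanish F x.

(** Segre embedding: the point with homogeneous coordinates [x i * y j]. *)
Definition segre N M (x : 'rV[algC]_N) (y : 'rV[algC]_M) : 'rV[algC]_(N * M) :=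
  mxvec (x^T *m y).

Definition product_points N M (X : qpvar N) (Y : qpvar M)
    (z : 'rV[algC]_(N * M)) :=
  exists x y, [/\ X x, Y y & z = segre x y].

Lemma evE N (p : {mpoly rat[N]}) x :
  ev p x = \sum_(m <- msupp p) ratr p@_m * \prod_(i < N) x 0 i ^+ m i.
Proof. by []. Qed.

Lemma evX N (i : 'I_N) x : ev 'X_i x = x 0 i.
Proof. by rewrite /ev mmapX mmap1U. Qed.

Lemma evM N (p q : {mpoly rat[N]}) x : ev (p * q) x = ev p x * ev q x.
Proof. exact: rmorphM. Qed.

Lemma evB N (p q : {mpoly rat[N]}) x : ev (p - q) x = ev p x - ev q x.
Proof. exact: rmorphB. Qed.

Lemma ev_sum N (I : Type) (r : seq I) (F : I -> {mpoly rat[N]}) x :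
  ev (\sum_(i <- r) F i) x = \sum_(i <- r) ev (F i) x.
Proof. exact: (raddf_sum (mmap ratr (x 0))). Qed.

Lemma evZ N a (p : {mpoly rat[N]}) x : ev (a *: p) x = ratr a * ev p x.
Proof. exact: mmapZ. Qed.

Lemma evXn N (p : {mpoly rat[N]}) k x : ev (p ^+ k) x = ev p x ^+ k.
Proof. exact: (rmorphXn (mmap ratr (x 0))). Qed.

Lemma ev_monom N K (u : 'I_N -> 'I_K) (m : 'X_{1..N}) x :
  ev (\prod_(i < N) 'X_(u i) ^+ m i) x = \prod_(i < N) x 0 (u i) ^+ m i.
Proof.
rewrite /ev (rmorph_prod (mmap ratr (x 0))); apply: eq_bigr => i _.
by rewrite -[LHS]/(ev ('X_(u i) ^+ m i) x) evXn evX.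
Qed.

Lemma ev_scale N (p : {mpoly rat[N]}) d c x :
  p \is d.-homog -> ev p (c *: x) = c ^+ d * ev p x.
Proof.
move=> /dhomogP hp; rewrite !evE mulr_sumr !big_seq; apply: eq_bigr => m mp.
rewrite mulrCA; congr (_ * _); rewrite -(hp m mp) /= mdegE -prodrXr -big_split /=.
by apply: eq_bigr => i _; rewrite mxE exprMn.
Qed.

Lemma ev_scale0 N (p : {mpoly rat[N]}) c x : p \is homog mdeg ->
  c != 0 -> (ev p (c *: x) == 0) = (ev p x == 0).
Proof.
case/homogP=> d hp c0; rewrite (ev_scale _ _ hp) mulf_eq0 expf_eq0.
by rewrite (negPf c0) andbF.
Qed.

Lemma vanish_scale N (F : seq {mpoly rat[N]}) c x : homogeneous F ->
  c != 0 -> vanish F (c *: x) <-> vanish F x.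
Proof.
move=> hF c0; split=> vF p pF; apply/eqP.
  by rewrite -(ev_scale0 _ (hF _ pF) c0) vF.
by rewrite (ev_scale0 _ (hF _ pF) c0) vF.
Qed.

Lemma nvanishP N (F : seq {mpoly rat[N]}) x :
  ~ vanish F x <-> exists2 p, p \in F & ev p x != 0.
Proof.
split=> [nv|[p pF px] vF]; last by rewrite vF ?eqxx in px.
have [/hasP[p pF px]|/hasPn nF] := boolP (has (fun p => ev p x != 0) F).
  by exists p.
by case: nv => p /nF /negPn /eqP.
Qed.

Lemma lc_scale N (X : qpvar N) c x : c != 0 -> X x -> X (c *: x).
Proof.
case: X => A [F [H [hF hH AE]]] /= c0 /AE [x0 vF vH]; apply/AE; split.
- by rewrite scaler_eq0 negb_or c0.
- exact/vanish_scale.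
- by move/vanish_scale=> /(_ hH c0).
Qed.

(* Substitution of the variable ['X_(u i)] for ['X_i]. *)
Definition msubst N K (u : 'I_N -> 'I_K) (p : {mpoly rat[N]}) : {mpoly rat[K]} :=
  \sum_(m <- msupp p) p@_m *: \prod_(i < N) 'X_(u i) ^+ m i.

Lemma ev_msubst N K (u : 'I_N -> 'I_K) p z :
  ev (msubst u p) z = ev p (\row_i z 0 (u i)).
Proof.
rewrite [RHS]evE /msubst ev_sum; apply: eq_bigr => m _.
by rewrite evZ ev_monom; congr (_ * _); apply: eq_bigr => i _; rewrite mxE.
Qed.

Lemma dhomogXi N (i : 'I_N) : ('X_i : {mpoly rat[N]}) \is 1.-homog.
Proof. by rewrite dhomogX /= mdeg1. Qed.

Lemma dhomog_prodX N K (u : 'I_N -> 'I_K) (m : 'X_{1..N}) :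
  (\prod_(i < N) 'X_(u i) ^+ m i : {mpoly rat[K]}) \is (mdeg m).-homog.
Proof.
rewrite mdegE; elim/big_rec2: _ => [|i d p _ IH]; first exact: dhomog1.
rewrite dhomogM //; have := dhomogMn (m i) (dhomogXi (u i)); by rewrite mul1n.
Qed.

Lemma homog_msubst N K (u : 'I_N -> 'I_K) p :
  p \is homog mdeg -> msubst u p \is homog mdeg.
Proof.
case/homogP=> d /dhomogP hp; apply/homogP; exists d.
rewrite /msubst big_seq; apply: rpred_sum => m mp; apply: rpredZ.
by rewrite -(hp m mp) dhomog_prodX.
Qed.

Lemma homogM N (p q : {mpoly rat[N]}) :
  p \is homog mdeg -> q \is homog mdeg -> p * q \is homog mdeg.
Proof.
case/homogP=> d hp /homogP[e hq]; apply/homogP; exists (d + e)%N.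
exact: dhomogM.
Qed.

Lemma homogX N (i : 'I_N) : ('X_i : {mpoly rat[N]}) \is homog mdeg.
Proof. by apply/homogP; exists 1%N; apply: dhomogXi. Qed.

Section Segre.
Variables (N M : nat) (X : qpvar N) (Y : qpvar M).
Implicit Types (x : 'rV[algC]_N) (y : 'rV[algC]_M) (z : 'rV[algC]_(N * M)).

Let zx z j : 'rV[algC]_N := \row_i z 0 (mxvec_index i j).
Let zy z i : 'rV[algC]_M := \row_j z 0 (mxvec_index i j).
Let u j (i : 'I_N) : 'I_(N * M) := mxvec_index i j.
Let v i (j : 'I_M) : 'I_(N * M) := mxvec_index i j.
Let Z i j : {mpoly rat[N * M]} := 'X_(mxvec_index i j).

Let segreE x y i j : segre x y 0 (mxvec_index i j) = x 0 i * y 0 j.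
Proof. by rewrite mxvecE mxE big_ord1 mxE. Qed.

Let zx_segre x y j : zx (segre x y) j = y 0 j *: x.
Proof. by apply/rowP => i; rewrite !mxE segreE mulrC. Qed.

Let zy_segre x y i : zy (segre x y) i = x 0 i *: y.
Proof. by apply/rowP => j; rewrite !mxE segreE. Qed.

Lemma product_locally_closed : locally_closed (product_points X Y).
Proof.
have [F [H [hF hH XE]]] := points_locally_closed X.
have [F' [H' [hF' hH' YE]]] := points_locally_closed Y.
pose minors : seq {mpoly rat[N * M]} := [seq Z a.1.1 a.2.1 * Z a.1.2 a.2.2 - Z a.1.1 a.2.2 * Z a.1.2 a.2.1
  | a <- enum {: ('I_N * 'I_N) * ('I_M * 'I_M)}].
pose EX : seq {mpoly rat[N * M]} := [seq msubst (u j) p | p <- F, j <- enum 'I_M].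
pose EY : seq {mpoly rat[N * M]} := [seq msubst (v i) p | p <- F', i <- enum 'I_N].
pose B := [seq (i, j) | i <- enum 'I_N, j <- enum 'I_M].
pose C := [seq (p, q) | p <- H, q <- H'].
pose O : seq {mpoly rat[N * M]} := [seq msubst (u b.2) c.1 * msubst (v b.1) c.2 * Z b.1 b.2
  | c <- C, b <- B].
have evu (p : {mpoly rat[N]}) z j : ev (msubst (u j) p) z = ev p (zx z j) by rewrite ev_msubst.
have evv (p : {mpoly rat[M]}) z i : ev (msubst (v i) p) z = ev p (zy z i) by rewrite ev_msubst.
exists (minors ++ EX ++ EY), O; split.
- move=> p; rewrite !mem_cat => /or3P[] => [/mapP[a _ ->]|/allpairsP[[q j] [qF _ ->]]|/allpairsP[[q j] [qF _ ->]]].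
  + apply/homogP; exists 2%N.
    by apply: rpredB; apply: (@dhomogM _ _ _ 1 _ 1); apply: dhomogXi.
  + exact/homog_msubst/hF.
  + exact/homog_msubst/hF'.
- move=> p /allpairsP[[[q q'] b] [/allpairsP[[r r'] [/= rH rH' [-> ->]]] _ ->]] /=.
  by rewrite !homogM ?homogX ?homog_msubst ?hH ?hH'.
move=> z; split.
- move=> [x [y [/XE [x0 xF xH] /YE [y0 yF yH] ->]]].
  have [i xi] : exists i, x 0 i != 0 by apply/rV0Pn.
  have [j yj] : exists j, y 0 j != 0 by apply/rV0Pn.
  split.
  + apply/rV0Pn; exists (mxvec_index i j).
    by rewrite segreE mulf_neq0.
  + move=> p; rewrite !mem_cat => /or3P[/mapP[a _ ->]|/allpairsP[[q k] [/= qF _ ->]]|/allpairsP[[q k] [/= qF _ ->]]].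
    * by rewrite evB !evM !evX !segreE mulrACA [X in _ - X]mulrACA [X in _ - _ * X]mulrC subrr.
    * rewrite evu zx_segre; have [d hd] := homogP _ _ (hF _ qF).
      by rewrite (ev_scale _ _ hd) xF ?mulr0.
    * rewrite evv zy_segre; have [d hd] := homogP _ _ (hF' _ qF).
      by rewrite (ev_scale _ _ hd) yF ?mulr0.
  + have [p pH px] := (nvanishP _ _).1 xH.
    have [q qH qy] := (nvanishP _ _).1 yH.
    apply/nvanishP; exists (msubst (u j) p * msubst (v i) q * Z i j).
      apply/allpairsP; exists ((p, q), (i, j)); split=> //=.
        by apply/allpairsP; exists (p, q).
      by apply/allpairsP; exists (i, j); rewrite !mem_enum.
    rewrite !evM evu evv zx_segre zy_segre evX segreE.
    by rewrite !mulf_neq0 // ev_scale0 ?hH ?hH'.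
- move=> [z0 vz /nvanishP[r /allpairsP[[[p q] [i j]] [/= cC _ ->]]]].
  have [[p' q'] [/= pH qH [? ?]]] := allpairsP cC; subst p' q'.
  rewrite !evM evu evv evX !mulf_eq0 !negb_or -andbA => /and3P[px qy zij].
  exists (zx z j), ((z 0 (mxvec_index i j))^-1 *: zy z i); split.
  + apply/XE; split.
    * by apply/rV0Pn; exists i; rewrite mxE.
    * move=> f fF; rewrite -evu vz // !mem_cat; apply/or3P/Or32.
      by apply/allpairsP; exists (f, j); rewrite mem_enum.
    * by apply/nvanishP; exists p.
  + apply: lc_scale; first by rewrite invr_neq0.
    apply/YE; split.
    * by apply/rV0Pn; exists j; rewrite mxE.
    * move=> f fF; rewrite -evv vz // !mem_cat; apply/or3P/Or33.
      by apply/allpairsP; exists (f, i); rewrite mem_enum.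
    * by apply/nvanishP; exists q.
  + apply/rowP => k; case/mxvec_indexP: k => k l.
    rewrite segreE !mxE mulrCA; apply: (mulfI zij); rewrite mulVKf //.
    have /eqP : ev (Z i j * Z k l - Z i l * Z k j) z = 0.
      apply: vz; rewrite mem_cat; apply/orP; left; apply/mapP.
      by exists ((i, k), (j, l)); rewrite ?mem_enum.
    by rewrite evB !evM !evX subr_eq0 => /eqP ->; rewrite mulrC.
Qed.

Definition product : qpvar (N * M) := QPVar product_locally_closed.
End Segre.

(** ** Affine hypersurface complements

    A^n is the chart [x 0 0 != 0] of P^n, with affine coordinates
    [x 0 i.+1 / x 0 0]. *)

Definition affine_coords n (x : 'rV[algC]_n.+1) : 'rV[algC]_n :=
  \row_i (x 0 (lift ord0 i) / x 0 0).

Definition compl_points n (p : {mpoly rat[n]}) (x : 'rV[algC]_n.+1) :=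
  x 0 0 != 0 /\ ev p (affine_coords x) != 0.

Lemma compl_locally_closed n (p : {mpoly rat[n]}) :
  locally_closed (compl_points p).
Proof.
pose q : {mpoly rat[n.+1]} := \sum_(m <- msupp p) p@_m *:
  ('X_ord0 ^+ (msize p - mdeg m) * \prod_(i < n) 'X_(lift ord0 i) ^+ m i).
have q_homog : q \is (msize p).-homog.
  rewrite /q big_seq; apply: rpred_sum => m mp; apply: rpredZ.
  rewrite -{2}(subnK (ltnW (msize_mdeg_lt mp))).
  apply: dhomogM; last exact: dhomog_prodX.
  by have := dhomogMn (msize p - mdeg m) (dhomogXi (@ord0 n)); rewrite mul1n.
have q_ev (x : 'rV[algC]_n.+1) : x 0 0 != 0 -> ev q x = x 0 0 ^+ msize p * ev p (affine_coords x).
  move=> x0; rewrite [in RHS]evE mulr_sumr /q ev_sum big_seq [RHS]big_seq.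
  apply: eq_bigr => m mp; rewrite evZ evM evXn evX ev_monom.
  rewrite [in RHS]mulrCA.
  congr (_ * _); rewrite -{2}(subnK (ltnW (msize_mdeg_lt mp))) exprD -mulrA.
  congr (_ * _); rewrite mdegE -prodrXr -big_split; apply: eq_bigr => i _ /=.
  by rewrite -exprMn; congr (_ ^+ _); rewrite mxE mulrC divfK.
exists [::], [:: 'X_ord0 * q]; split=> //.
  move=> r; rewrite inE => /eqP ->; apply: homogM; first exact: homogX.
  exact: homogE q_homog.
move=> x; split.
- move=> [x0 px]; split=> //; first by apply/rV0Pn; exists ord0.
  apply/nvanishP; exists ('X_ord0 * q); first exact: mem_head.
  by rewrite evM evX q_ev // !mulf_neq0 // expf_neq0.
- move=> [_ _ /nvanishP[r]]; rewrite inE => /eqP ->.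
  rewrite evM evX mulf_eq0 negb_or => /andP[x0].
  by rewrite q_ev // mulf_eq0 negb_or => /andP[].
Qed.

Definition hypersurface_compl n (p : {mpoly rat[n]}) : qpvar n.+1 :=
  QPVar (compl_locally_closed p).

Definition affine_space n : qpvar n.+1 := hypersurface_compl (1 : {mpoly rat[n]}).

(** * The Grothendieck ring of varieties

    The commutative ring presented by the generators [X] (quasi-projective
    varieties over Q) and the relations [kvar_iso], [kvar_scissor],
    [kvar_product] and [kvar_point]: ring expressions in the generators modulo
    the least congruence containing the relations and the ring axioms.
    [kvar_point] says that the unit is the class of a point, as it must be for
    [X] * [Y] = [X x Y] to define the product on the additive group generated
    by the classes. *)

Inductive kexpr : Type :=
| KVarClass N of qpvar N
| KZero
| KOne
| KOpp of kexpr
| KAdd of kexpr & kexpr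
| KMul of kexpr & kexpr.

Inductive kequiv : kexpr -> kexpr -> Prop :=
| kvar_iso N M (X : qpvar N) (Y : qpvar M) :
    isomorphic X Y -> kequiv (KVarClass X) (KVarClass Y)
| kvar_scissor N (X Y U : qpvar N) :
    closed_in Y X -> (forall x, U x <-> X x /\ ~ Y x) ->
    kequiv (KVarClass X) (KAdd (KVarClass U) (KVarClass Y))
| kvar_product N M (X : qpvar N) (Y : qpvar M) :
    kequiv (KMul (KVarClass X) (KVarClass Y)) (KVarClass (product X Y))
| kvar_point : kequiv KOne (KVarClass (affine_space 0))
| kequiv_refl a : kequiv a a
| kequiv_sym a b : kequiv a b -> kequiv b a
| kequiv_trans b a c : kequiv a b -> kequiv b c -> kequiv a c
| kequiv_opp a a' : kequiv a a' -> kequiv (KOpp a) (KOpp a')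
| kequiv_add a a' b b' :
    kequiv a a' -> kequiv b b' -> kequiv (KAdd a b) (KAdd a' b')
| kequiv_mul a a' b b' :
    kequiv a a' -> kequiv b b' -> kequiv (KMul a b) (KMul a' b')
| kaddA a b c : kequiv (KAdd a (KAdd b c)) (KAdd (KAdd a b) c)
| kaddC a b : kequiv (KAdd a b) (KAdd b a)
| kadd0 a : kequiv (KAdd KZero a) a
| kaddN a : kequiv (KAdd (KOpp a) a) KZero
| kmulA a b c : kequiv (KMul a (KMul b c)) (KMul (KMul a b) c)
| kmulC a b : kequiv (KMul a b) (KMul b a)
| kmul1 a : kequiv (KMul KOne a) a
| kmulDl a b c : kequiv (KMul (KAdd a b) c) (KAdd (KMul a c) (KMul b c)).

HB.instance Definition _ := gen_eqMixin kexpr.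
HB.instance Definition _ := gen_choiceMixin kexpr.

Definition kequivb (a b : kexpr) : bool := `[< kequiv a b >].

Lemma kequivb_equiv : equiv_class_of kequivb.
Proof.
split=> [a|a b|b a c].
- exact/asboolP/kequiv_refl.
- by apply/asboolP/asboolP; apply: kequiv_sym.
- by move=> /asboolP ab /asboolP bc; apply/asboolP/(kequiv_trans ab bc).
Qed.

Canonical kequiv_rel := EquivRelPack kequivb_equiv.

Definition KVar := {eq_quot kequiv_rel}.
HB.instance Definition _ := Choice.on KVar.
HB.instance Definition _ := EqQuotient.on KVar.

Lemma kpiP (a b : kexpr) : \pi_KVar a = \pi_KVar b <-> kequiv a b.
Proof.
by split=> [/eqquotP/asboolP|ab] //; apply/eqquotP/asboolP.
Qed.

Lemma krepr (a : kexpr) : kequiv (repr (\pi_KVar a)) a.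
Proof. by apply/kpiP; rewrite reprK. Qed.

Definition kvar_opp (x : KVar) : KVar := \pi_KVar (KOpp (repr x)).
Definition kvar_add (x y : KVar) : KVar := \pi_KVar (KAdd (repr x) (repr y)).
Definition kvar_mul (x y : KVar) : KVar := \pi_KVar (KMul (repr x) (repr y)).

Lemma kpi_opp a : kvar_opp (\pi_KVar a) = \pi_KVar (KOpp a).
Proof. apply/kpiP/kequiv_opp/krepr. Qed.

Lemma kpi_add a b : kvar_add (\pi_KVar a) (\pi_KVar b) = \pi_KVar (KAdd a b).
Proof. by apply/kpiP/kequiv_add; apply: krepr. Qed.

Lemma kpi_mul a b : kvar_mul (\pi_KVar a) (\pi_KVar b) = \pi_KVar (KMul a b).
Proof. by apply/kpiP/kequiv_mul; apply: krepr. Qed.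

Lemma kvar_ind (P : KVar -> Prop) : (forall a, P (\pi_KVar a)) -> forall x, P x.
Proof. by move=> Ppi x; rewrite -[x]reprK. Qed.

Fact kvar_addA : associative kvar_add.
Proof.
elim/kvar_ind=> a; elim/kvar_ind=> b; elim/kvar_ind=> c.
by rewrite !kpi_add; apply/kpiP/kaddA.
Qed.

Fact kvar_addC : commutative kvar_add.
Proof.
by elim/kvar_ind=> a; elim/kvar_ind=> b; rewrite !kpi_add; apply/kpiP/kaddC.
Qed.

Fact kvar_add0 : left_id (\pi_KVar KZero) kvar_add.
Proof. by elim/kvar_ind=> a; rewrite kpi_add; apply/kpiP/kadd0. Qed.

Fact kvar_addN : left_inverse (\pi_KVar KZero) kvar_opp kvar_add.
Proof. by elim/kvar_ind=> a; rewrite kpi_opp kpi_add; apply/kpiP/kaddN. Qed.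

HB.instance Definition _ :=
  GRing.isZmodule.Build KVar kvar_addA kvar_addC kvar_add0 kvar_addN.

Fact kvar_mulA : associative kvar_mul.
Proof.
elim/kvar_ind=> a; elim/kvar_ind=> b; elim/kvar_ind=> c.
by rewrite !kpi_mul; apply/kpiP/kmulA.
Qed.

Fact kvar_mulC : commutative kvar_mul.
Proof.
by elim/kvar_ind=> a; elim/kvar_ind=> b; rewrite !kpi_mul; apply/kpiP/kmulC.
Qed.

Fact kvar_mul1 : left_id (\pi_KVar KOne) kvar_mul.
Proof. by elim/kvar_ind=> a; rewrite kpi_mul; apply/kpiP/kmul1. Qed.

Fact kvar_mulDl : left_distributive kvar_mul (@GRing.add KVar).
Proof.
elim/kvar_ind=> a; elim/kvar_ind=> b; elim/kvar_ind=> c.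
by rewrite /GRing.add /= kpi_add !kpi_mul kpi_add; apply/kpiP/kmulDl.
Qed.

HB.instance Definition _ :=
  GRing.Zmodule_isComPzRing.Build KVar kvar_mulA kvar_mulC kvar_mul1 kvar_mulDl.

Definition kclass N (X : qpvar N) : KVar := \pi_KVar (KVarClass X).

Definition lefschetz : KVar := kclass (affine_space 1).

Definition eq_mod_ideal (R : comPzRingType) (c x y : R) :=
  exists a : R, x - y = a * c.

(** * Graphs and graph polynomials

    Edges are unoriented: [src] and [tgt] name the two ends of an edge in an
    arbitrary order. *)

Record graph := Graph {
  vertex : finType;
  nedges : nat;
  src : 'I_nedges -> vertex;
  tgt : 'I_nedges -> vertex }.

Section Graph.
Variable G : graph.
Implicit Types (C : {set vertex G}) (A T : {set 'I_(nedges G)}).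

Definition looping_edge (e : 'I_(nedges G)) := src e == tgt e.

Definition adjacent A : rel (vertex G) := fun u v =>
  [exists e in A, (src e == u) && (tgt e == v) || (src e == v) && (tgt e == u)].

Definition components : {set {set vertex G}} :=
  [set [set v | connect (adjacent setT) u v] | u : vertex G].

Definition edges_of C : {set 'I_(nedges G)} := [set e | src e \in C].

(* A dart is an edge with a direction of travel. *)
Definition dart : Type := 'I_(nedges G) * bool.
Definition dsrc (d : dart) := if d.2 then src d.1 else tgt d.1.
Definition dtgt (d : dart) := if d.2 then tgt d.1 else src d.1.

Definition is_cycle (c : seq dart) :=
  [&& c != [::], cycle (fun d d' => dtgt d == dsrc d') c,
      uniq (map dsrc c) & uniq (map fst c)].

(* The spanning tree is given by its set of edges; its vertex set is C. *)
Definition spanning_tree C T : Prop :=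
  [/\ T \subset edges_of C,
      {in C &, forall u v, connect (adjacent T) u v} &
      forall c : seq dart, is_cycle c -> ~ {subset map fst c <= T}].

Definition component_poly C : {mpoly rat[nedges G]} :=
  \sum_(T : {set 'I_(nedges G)} | `[< spanning_tree C T >])
     \prod_(e in edges_of C :\: T) 'X_e.

Definition graph_poly : {mpoly rat[nedges G]} :=
  \prod_(C in components) component_poly C.

Definition graph_compl : qpvar (nedges G).+1 := hypersurface_compl graph_poly.
End Graph.

(* Main.v *)
Require Import Defs.
From mathcomp Require Import all_boot all_order all_algebra all_field.
From mathcomp Require Import boolp mpoly.
From mathcomp Require Import ring.

(** The argument only uses that psi_G is linear in each variable. Write
    p = t f + g with f and g free of the variable t. The locus f = 0, g <> 0 of
    Y_p is a cylinder over t, so its class is a multiple of L; on f <> 0 the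
    translation of t by g / f turns p into t f. Hence [Y_p] = [Y_(t f)] mod L,
    and iterating over all variables leaves [Y_(c t_1 ... t_n)], where c is the
    coefficient of t_1 ... t_n in p. For p = psi_G, c = 0 as soon as some edge
    is not a loop, since then the empty set is not a spanning forest. If all
    edges are loops, psi_G = t_1 ... t_n, and the torus (A^1 - 0)^n has class
    (-1)^n mod L by cutting along the coordinate hyperplanes. *)

Set Implicit Arguments.
Unset Strict Implicit.
Unset Printing Implicit Defensive.
Import GRing.Theory.
Local Open Scope ring_scope.

(** * Congruences and the relations of the Grothendieck ring *)

Lemma eq_mod_idealxx (R : comPzRingType) (c x : R) : eq_mod_ideal c x x.
Proof. by exists 0; rewrite subrr mul0r. Qed.

Lemma eq_mod_ideal_trans (R : comPzRingType) (c y x z : R) :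
  eq_mod_ideal c x y -> eq_mod_ideal c y z -> eq_mod_ideal c x z.
Proof.
by case=> a xy [b yz]; exists (a + b); rewrite mulrDl -xy -yz addrA subrK.
Qed.

Lemma eq_mod_idealN (R : comPzRingType) (c x y : R) :
  eq_mod_ideal c x y -> eq_mod_ideal c (- x) (- y).
Proof. by case=> a xy; exists (- a); rewrite mulNr -xy opprB opprK addrC. Qed.

Lemma kclass_iso N M (X : qpvar N) (Y : qpvar M) :
  isomorphic X Y -> kclass X = kclass Y.
Proof. by move=> XY; apply/kpiP/kvar_iso. Qed.

Lemma kclass_scissor N (X Y U : qpvar N) :
  closed_in Y X -> (forall x, U x <-> X x /\ ~ Y x) ->
  kclass X = kclass U + kclass Y.
Proof.
by move=> cY XU; rewrite /GRing.add /= /kclass kpi_add; apply/kpiP/kvar_scissor.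
Qed.

Lemma kclass_product N M (X : qpvar N) (Y : qpvar M) :
  kclass (product X Y) = kclass X * kclass Y.
Proof.
by rewrite /GRing.mul /= /kclass kpi_mul; apply/kpiP/kequiv_sym/kvar_product.
Qed.

Lemma kclass_point : kclass (affine_space 0) = 1.
Proof. exact/esym/kpiP/kvar_point. Qed.

Lemma qpvar_neq0 N (X : qpvar N) x : X x -> x != 0.
Proof. by case: X => A [F [H [hF hH AE]]] /= /AE[]. Qed.

Lemma same_point_refl N (x : 'rV[algC]_N) : same_point x x.
Proof. by exists 1; rewrite ?oner_neq0 ?scale1r. Qed.

(** Every morphism constructed below is given by a single family of forms on the whole of X. The
    forms have no common zero on X because points of [Y] are nonzero vectors. *)
Lemma morphism_forms N M (X : qpvar N) (Y : qpvar M) d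
    (h : 'I_M -> {mpoly rat[N]}) :
  (forall j, h j \is d.-homog) ->
  (forall x, X x -> Y (\row_j ev (h j) x)) ->
  morphism X Y (fun x => \row_j ev (h j) x).
Proof.
move=> hh XY x Xx; split; first exact: XY.
exists d, h; split=> // [|y _ _]; first exact: qpvar_neq0 (XY x Xx).
exact: same_point_refl.
Qed.

Lemma kclass_ext N (X Y : qpvar N) :
  (forall x, X x <-> Y x) -> kclass X = kclass Y.
Proof.
move=> XY.
have idE x : \row_j ev 'X_j x = x :> 'rV[algC]_N.
  by apply/rowP=> j; rewrite mxE evX.
apply/kclass_iso.
exists (fun x => \row_j ev 'X_j x), (fun x => \row_j ev 'X_j x).
split=> [||x _|x _]; rewrite ?idE; try exact: same_point_refl.
  by apply: (@morphism_forms _ _ _ _ 1%N) => [j|x /XY]; rewrite ?dhomogXi ?idE.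
by apply: (@morphism_forms _ _ _ _ 1%N) => [j|x /XY]; rewrite ?dhomogXi ?idE.
Qed.

(** An empty X is the disjoint union of itself with itself, so [X] = [X] + [X]. *)
Lemma kclass_empty N (X : qpvar N) : (forall x, ~ X x) -> kclass X = 0.
Proof.
move=> X0; apply/(addrI (kclass X)); rewrite addr0; apply/esym/kclass_scissor.
  by exists [::] => // x; split=> [/X0|[/X0]].
by move=> x; split=> [/X0|[/X0]].
Qed.

(** * Closed and open parts of a variety *)

Lemma closed_part_lc N (X : qpvar N) (F : seq {mpoly rat[N]}) :
  homogeneous F -> locally_closed (fun x => X x /\ vanish F x).
Proof.
move=> hF; have [F' [H [hF' hH XE]]] := points_locally_closed X.
exists (F' ++ F), H; split=> // [p|x].
  by rewrite mem_cat => /orP[/hF'|/hF].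
split=> [[/XE[x0 vF' vH] vF]|[x0 vF vH]].
  by split=> // p; rewrite mem_cat => /orP[/vF'|/vF].
split; last by move=> p pF; apply: vF; rewrite mem_cat pF orbT.
by apply/XE; split=> // p pF; apply: vF; rewrite mem_cat pF.
Qed.

Definition closed_part N (X : qpvar N) F (hF : homogeneous F) : qpvar N :=
  QPVar (closed_part_lc X hF).

Lemma open_part_lc N (X : qpvar N) (F : seq {mpoly rat[N]}) :
  homogeneous F -> locally_closed (fun x => X x /\ ~ vanish F x).
Proof.
move=> hF; have [F' [H [hF' hH XE]]] := points_locally_closed X.
(* Some form of [H] and some form of [F] are nonzero at a point exactly when one of these products
   is. *)
exists F', [seq p * q | p <- H, q <- F]; split=> // [r|x].
  move=> /allpairsP[[p q] [/= pH qF ->]].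
  by apply: homogM; [apply: hH|apply: hF].
split=> [[/XE[x0 vF' /nvanishP[p pH px]] /nvanishP[q qF qx]]|].
  split=> //; apply/nvanishP; exists (p * q); last by rewrite evM mulf_neq0.
  by apply/allpairsP; exists (p, q).
case=> x0 vF' /nvanishP[r /allpairsP[[p q] [/= pH qF ->]]].
rewrite evM mulf_eq0 negb_or => /andP[px qx]; split; last first.
  by apply/nvanishP; exists q.
by apply/XE; split=> //; apply/nvanishP; exists p.
Qed.

Definition open_part N (X : qpvar N) F (hF : homogeneous F) : qpvar N :=
  QPVar (open_part_lc X hF).

Lemma kclass_parts N (X : qpvar N) F (hF : homogeneous F) :
  kclass X = kclass (open_part X hF) + kclass (closed_part X hF).
Proof.
apply: kclass_scissor; first by exists F.
move=> x; split=> [[Xx vF]|[Xx nF]]; split=> //; first by case.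
by move=> vF; apply: nF; split.
Qed.

(** * Cylinders over a coordinate hyperplane *)

Lemma ev1 N x : ev (1 : {mpoly rat[N]}) x = 1.
Proof. exact: (rmorph1 (mmap ratr (x 0))). Qed.

Lemma homogeneous1 N (p : {mpoly rat[N]}) :
  p \is homog mdeg -> homogeneous [:: p].
Proof. by move=> hp q; rewrite inE => /eqP ->. Qed.

Lemma vanish1 N (p : {mpoly rat[N]}) x : vanish [:: p] x <-> ev p x = 0.
Proof.
by split=> [|px q]; [apply; rewrite mem_head | rewrite inE => /eqP ->].
Qed.

(** Let Z be the slice x_i = 0. Setting the i-th coordinate to 0 and recording it in the point (x_0
    : x_i) of A^1 identifies X with Z x A^1; the inverse is (x, y) |-> y_0 x + x_0 y_1 e_i. *)
Lemma kclass_cylinder n (i : 'I_n.+1) (X : qpvar n.+1) : i != ord0 ->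
  (forall x, X x -> x 0 0 != 0) ->
  (forall x c, X x -> X (x + c *: delta_mx 0 i)) ->
  kclass X = kclass (closed_part X (homogeneous1 (homogX i))) * lefschetz.
Proof.
move=> i0 X0 Xc; set Z := closed_part _ _; rewrite -kclass_product.
pose a_ (a : 'I_n.+1) : {mpoly rat[n.+1]} := if a == i then 0 else 'X_a.
pose b_ (b : 'I_2) : {mpoly rat[n.+1]} := if b == 0 then 'X_ord0 else 'X_i.
pose h k := mxvec (\matrix_(a, b) (a_ a * b_ b)) 0 k.
(* The inverse needs only the Segre entries z_(a,0) = x_a y_0 for a <> i and z_(0,1) = x_0 y_1, so
   it is linear in z. *)
pose h' a : {mpoly rat[n.+1 * 2]} :=
  'X_(if a == i then mxvec_index 0 1 else mxvec_index a 0).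
pose xa (x : 'rV[algC]_n.+1) : 'rV[algC]_n.+1 := x - x 0 i *: delta_mx 0 i.
pose xb (x : 'rV[algC]_n.+1) : 'rV[algC]_2 :=
  \row_b if b == 0 then x 0 0 else x 0 i.
have hE x : \row_k ev (h k) x = segre (xa x) (xb x).
  apply/rowP => k; rewrite mxE /h; case/mxvec_indexP: k => a b.
  rewrite !mxvecE !mxE big_ord1 !mxE eqxx /= evM /a_ /b_; congr (_ * _).
    have [->|ai] := eqVneq a i; last by rewrite evX mulr0 subr0.
    by rewrite mulr1 subrr /ev mmap0.
  by case: ifP => _; rewrite evX.
have segreE (x : 'rV[algC]_n.+1) (y : 'rV[algC]_2) a b :
    segre x y 0 (mxvec_index a b) = x 0 a * y 0 b.
  by rewrite mxvecE mxE big_ord1 mxE.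
have h'E (x : 'rV[algC]_n.+1) (y : 'rV[algC]_2) : x 0 i = 0 ->
    \row_a ev (h' a) (segre x y) = y 0 0 *: x + (x 0 0 * y 0 1) *: delta_mx 0 i.
  move=> xi; apply/rowP => a; rewrite !mxE evX /h' eqxx /=.
  have [->|ai] := eqVneq a i; rewrite segreE.
    by rewrite xi mulr0 add0r mulr1.
  by rewrite mulr0 addr0 mulrC.
have xaZ x : X x -> Z (xa x).
  move=> Xx; split; first by rewrite /xa -scaleNr; apply: Xc.
  by apply/vanish1; rewrite evX /xa !mxE !eqxx mulr1 subrr.
have xbA x : X x -> affine_space 1 (xb x).
  by move=> Xx; split; [rewrite mxE X0 | rewrite ev1 oner_neq0].
have hX y x : Z x -> affine_space 1 y -> X (\row_a ev (h' a) (segre x y)).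
  move=> [Xx /vanish1]; rewrite evX => xi [y0 _]; rewrite h'E //.
  by apply: Xc; apply: lc_scale.
apply: kclass_iso.
exists (fun x => \row_k ev (h k) x), (fun z => \row_a ev (h' a) z).
split.
- apply: (@morphism_forms _ _ _ _ 2%N) => [k|x Xx]; last first.
    by rewrite hE; exists (xa x), (xb x); split; [apply: xaZ|apply: xbA|].
  rewrite /h; case/mxvec_indexP: k => a b; rewrite mxvecE mxE.
  apply: (@dhomogM _ _ _ 1 _ 1); last first.
    by rewrite /b_; case: ifP; rewrite dhomogXi.
  by rewrite /a_; case: ifP; rewrite ?dhomog0 ?dhomogXi.
- apply: (@morphism_forms _ _ _ _ 1%N) => [k|z [x [y [Zx Ay ->]]]].
    exact: dhomogXi.
  exact: hX.
- move=> x Xx; rewrite hE h'E; last by rewrite !mxE !eqxx mulr1 subrr.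
  exists (x 0 0)^-1; rewrite ?invr_neq0 ?X0 //.
  have x0 := X0 _ Xx.
  rewrite !mxE /= [_ == i]eq_sym (negPf i0) mulr0 subr0.
  rewrite -scalerA -scalerDr subrK.
  by rewrite scalerA mulVf ?scale1r.
- move=> z [x [y [[Xx /vanish1]]]]; rewrite evX => xi [y0 _] ->.
  rewrite hE h'E //.
  have x0 := X0 _ Xx.
  (* The two factors come back as y_0 x and x_0 y, so their Segre image is scaled by x_0 y_0. *)
  exists (y 0 0 * x 0 0)^-1; first by rewrite invr_eq0 mulf_neq0.
  have ->: xa (y 0 0 *: x + (x 0 0 * y 0 1) *: delta_mx 0 i) = y 0 0 *: x.
    by rewrite /xa !mxE !eqxx xi mulr0 add0r mulr1 addrK.
  have ->: xb (y 0 0 *: x + (x 0 0 * y 0 1) *: delta_mx 0 i) = x 0 0 *: y.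
    apply/rowP => b; rewrite !mxE !eqxx /= [_ == i]eq_sym (negPf i0) xi !mulr0.
    rewrite addr0 add0r mulr1; case: ifPn => [/eqP ->|b0]; first exact: mulrC.
    by congr (_ * y _ _); apply/val_inj; case: b b0 => [[|[|b]]].
  apply/rowP => k; case/mxvec_indexP: k => a b.
  by rewrite mxE !segreE !mxE; field; rewrite y0 x0.
Qed.

(** * Homogenization and affine coordinates *)

Lemma evD N (p q : {mpoly rat[N]}) x : ev (p + q) x = ev p x + ev q x.
Proof. exact: rmorphD. Qed.

Lemma ev0 N x : ev (0 : {mpoly rat[N]}) x = 0.
Proof. exact: mmap0. Qed.

(* Only meaningful when d bounds the degree of q, as [d - mdeg m] truncates. *)
Definition homogenize n d (q : {mpoly rat[n]}) : {mpoly rat[n.+1]} :=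
  \sum_(m <- msupp q) q@_m *:
    ('X_ord0 ^+ (d - mdeg m) * \prod_(i < n) 'X_(lift ord0 i) ^+ m i).

Lemma homogenize_homog n d (q : {mpoly rat[n]}) : (msize q <= d.+1)%N ->
  homogenize d q \is d.-homog.
Proof.
move=> qd; rewrite /homogenize big_seq; apply: rpred_sum => m mq; apply: rpredZ.
have md : (mdeg m <= d)%N by rewrite -ltnS (leq_trans (msize_mdeg_lt mq)).
rewrite -{2}(subnK md); apply: dhomogM; last exact: dhomog_prodX.
by have := dhomogMn (d - mdeg m) (dhomogXi (@ord0 n)); rewrite mul1n.
Qed.

Lemma ev_homogenize n d (q : {mpoly rat[n]}) (x : 'rV[algC]_n.+1) :
  (msize q <= d.+1)%N ->
  x 0 0 != 0 -> ev (homogenize d q) x = x 0 0 ^+ d * ev q (affine_coords x).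
Proof.
move=> qd x0; rewrite [in RHS]evE mulr_sumr /homogenize ev_sum big_seq.
rewrite [RHS]big_seq; apply: eq_bigr => m mq; rewrite evZ evM evXn evX ev_monom.
have md : (mdeg m <= d)%N by rewrite -ltnS (leq_trans (msize_mdeg_lt mq)).
rewrite [in RHS]mulrCA; congr (_ * _); rewrite -{2}(subnK md) exprD -mulrA.
congr (_ * _); rewrite mdegE -prodrXr -big_split; apply: eq_bigr => i _ /=.
by rewrite -exprMn; congr (_ ^+ _); rewrite mxE mulrC divfK.
Qed.

Lemma affine_coords_same_point n (x y : 'rV[algC]_n.+1) :
  x 0 0 != 0 -> y 0 0 != 0 -> affine_coords x = affine_coords y ->
  same_point x y.
Proof.
move=> x0 y0 xy; exists (y 0 0 / x 0 0); first by rewrite mulf_neq0 ?invr_eq0.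
apply/rowP=> j; rewrite mxE; have [j' ->|->] := unliftP ord0 j; last first.
  by rewrite divfK.
move/rowP: xy => /(_ j'); rewrite !mxE => xy.
by rewrite mulrAC -mulrA xy mulrC divfK.
Qed.

Lemma translate_coord n i c (x : 'rV[algC]_n) :
  (x + c *: delta_mx 0 i) 0 i = x 0 i + c.
Proof. by rewrite !mxE !eqxx mulr1. Qed.

(** * Polynomials of degree one in a variable *)

Definition indep n i (q : {mpoly rat[n]}) :=
  forall m, m \in msupp q -> m i = 0%N.

Lemma ev_indep n i (q : {mpoly rat[n]}) x c :
  indep i q -> ev q (x + c *: delta_mx 0 i) = ev q x.
Proof.
move=> qi; rewrite !evE !big_seq; apply: eq_bigr => m mq; congr (_ * _).
apply: eq_bigr => j _; rewrite !mxE eqxx /=.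
by have [->|_] := eqVneq j i; rewrite ?qi // mulr0 addr0.
Qed.

Lemma indepB n i (p q : {mpoly rat[n]}) :
  indep i p -> indep i q -> indep i (p - q).
Proof.
by move=> pi qi m /msuppB_le; rewrite mem_cat => /orP[/pi|/qi].
Qed.

(** The locus f <> 0 of Y_p. The number d is the degree to which f is homogenized; every admissible
    d gives the same points. *)
Definition hypersurface_open n d (p f : {mpoly rat[n]})
    (fd : (msize f <= d.+1)%N) : qpvar n.+1 :=
  open_part (hypersurface_compl p)
    (homogeneous1 (homogE (homogenize_homog fd))).

Lemma hypersurface_openP n d (p f : {mpoly rat[n]})
    (fd : (msize f <= d.+1)%N) x :
  hypersurface_open p fd x <->
  [/\ x 0 0 != 0, ev p (affine_coords x) != 0 & ev f (affine_coords x) != 0].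
Proof.
split=> [[[x0 px] nf]|[x0 px fx]]; do ?split=> //.
  apply/eqP=> fx; apply: nf; apply/vanish1.
  by rewrite ev_homogenize // fx mulr0.
move/vanish1/eqP; rewrite ev_homogenize // mulf_eq0 expf_eq0 (negPf x0) andbF.
by rewrite (negPf fx).
Qed.

(* Where f is invertible, translating t_i by (g1 - g2) / f takes t_i f + g1
   to t_i f + g2. *)
Lemma shear_morphism n d i (f g1 g2 : {mpoly rat[n]})
    (fd : (msize f <= d.+1)%N) :
  (msize (g1 - g2) <= d.+2)%N -> indep i f -> indep i g1 -> indep i g2 ->
  exists2 phi,
    morphism (hypersurface_open ('X_i * f + g1) fd)
             (hypersurface_open ('X_i * f + g2) fd) phi &
    forall x, hypersurface_open ('X_i * f + g1) fd x ->
      affine_coords (phi x) = affine_coords x +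
        (ev (g1 - g2) (affine_coords x) / ev f (affine_coords x))
          *: delta_mx 0 i.
Proof.
move=> gd fi g1i g2i.
pose F := homogenize d f; pose G := homogenize d.+1 (g1 - g2).
(* The translation cleared of its denominator f: all coordinates are multiplied by [F], and [G], of
   the same degree d + 1 as x_0 [F], is added to the coordinate of t_i. *)
pose h j := F * 'X_j + if j == lift ord0 i then G else 0.
have phi0 (x : 'rV[algC]_n.+1) : x 0 0 != 0 ->
    (\row_j ev (h j) x) 0 0 = ev F x * x 0 0.
  by rewrite mxE evD evM evX /= ev0 addr0.
have phiE (x : 'rV[algC]_n.+1) : x 0 0 != 0 -> ev f (affine_coords x) != 0 ->
    affine_coords (\row_j ev (h j) x) = affine_coords x +
      (ev (g1 - g2) (affine_coords x) / ev f (affine_coords x)) *: delta_mx 0 i.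
  move=> x0 fx; apply/rowP=> j; rewrite !mxE !evD !evM !evX /= ev0 addr0.
  rewrite (inj_eq lift_inj) /F ev_homogenize // ?eqxx.
  have [->|_] := eqVneq j i; last first.
    by rewrite ev0 /= mulr0; field; rewrite fx x0 expf_neq0.
  by rewrite ev_homogenize // exprS mulr1; field; rewrite fx x0 expf_neq0.
exists (fun x => \row_j ev (h j) x); last first.
  by move=> x /hypersurface_openP[x0 _ fx]; apply: phiE.
apply: (@morphism_forms _ _ _ _ d.+1) => [j|x /hypersurface_openP[x0 px fx]].
  rewrite /h; apply: rpredD; last first.
    by case: ifP => _; rewrite ?rpred0 // homogenize_homog.
  by have := dhomogM (homogenize_homog fd) (dhomogXi j); rewrite addn1.
apply/hypersurface_openP; rewrite phiE // (ev_indep _ _ fi); split=> //.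
  by rewrite phi0 // mulf_neq0 // /F ev_homogenize // mulf_neq0 ?expf_neq0.
rewrite [ev (_ + g2) _]evD evM evX (ev_indep _ _ fi) (ev_indep _ _ g2i) evB.
set a := affine_coords x in px fx *.
rewrite translate_coord.
move: px; rewrite evD evM evX; congr (_ != 0); by field.
Qed.

(** The inverse is the shear with g1 and g2 exchanged: neither f nor g1 - g2 involves t_i, so both
    keep their values under the first translation and the two displacements cancel. *)
Lemma shear_isomorphic n d i (f g1 g2 : {mpoly rat[n]})
    (fd : (msize f <= d.+1)%N) :
  (msize g1 <= d.+2)%N -> (msize g2 <= d.+2)%N ->
  indep i f -> indep i g1 -> indep i g2 ->
  isomorphic (hypersurface_open ('X_i * f + g1) fd)
             (hypersurface_open ('X_i * f + g2) fd).
Proof.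
move=> g1d g2d fi g1i g2i.
have gd (p q : {mpoly rat[n]}) : (msize p <= d.+2)%N -> (msize q <= d.+2)%N ->
    (msize (p - q) <= d.+2)%N.
  move=> pd qd; apply: leq_trans (msizeD_le _ _) _.
  by rewrite geq_max pd msizeN qd.
have [phi phiP phiE] := shear_morphism fd (gd _ _ g1d g2d) fi g1i g2i.
have [psi psiP psiE] := shear_morphism fd (gd _ _ g2d g1d) fi g2i g1i.
exists phi, psi; split=> // x Ux.
- have [Vx _] := phiP x Ux; have [Wx _] := psiP _ Vx.
  apply: affine_coords_same_point.
  + by case/hypersurface_openP: Wx.
  + by case/hypersurface_openP: Ux.
  rewrite psiE // phiE // !ev_indep //; last exact: indepB.
  by rewrite -[g2 - g1]opprB /ev mmapN mulNr scaleNr addrK.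
- have [Vx _] := psiP x Ux; have [Wx _] := phiP _ Vx.
  apply: affine_coords_same_point.
  + by case/hypersurface_openP: Wx.
  + by case/hypersurface_openP: Ux.
  rewrite phiE // psiE // !ev_indep //; last exact: indepB.
  by rewrite -[g1 - g2]opprB /ev mmapN mulNr scaleNr addrK.
Qed.

Lemma affine_coords_translate n i c (x : 'rV[algC]_n.+1) :
  affine_coords (x + c *: delta_mx 0 (lift ord0 i)) =
  affine_coords x + (c / x 0 0) *: delta_mx 0 i.
Proof.
apply/rowP=> j; rewrite !mxE !eqxx /= (inj_eq lift_inj) mulr0 addr0 mulrDl.
by rewrite mulrAC.
Qed.

Lemma translate0 n i c (x : 'rV[algC]_n.+1) :
  (x + c *: delta_mx 0 (lift ord0 i)) 0 0 = x 0 0.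
Proof. by rewrite !mxE /= mulr0 addr0. Qed.

Lemma kclass_multilinear n i (f g : {mpoly rat[n]}) :
  indep i f -> indep i g ->
  eq_mod_ideal lefschetz (kclass (hypersurface_compl ('X_i * f + g)))
                         (kclass (hypersurface_compl ('X_i * f))).
Proof.
move=> fi gi; pose d := maxn (msize f) (msize g).
have fd : (msize f <= d.+1)%N by apply: leqW; apply: leq_maxl.
have gd : (msize g <= d.+2)%N by do 2!apply: leqW; apply: leq_maxr.
have hF := homogeneous1 (homogE (homogenize_homog fd)).
rewrite (kclass_parts _ hF).
(* On f <> 0 the shear takes g to 0, and t_i f <> 0 already forces f <> 0. *)
have ->: kclass (open_part (hypersurface_compl ('X_i * f + g)) hF) =
    kclass (hypersurface_compl ('X_i * f)).
  transitivity (kclass (hypersurface_open ('X_i * f + g) fd)).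
    exact: kclass_ext.
  transitivity (kclass (hypersurface_open ('X_i * f + 0) fd)).
    apply/kclass_iso/shear_isomorphic => //; first by rewrite msize0.
    by move=> m; rewrite msupp0.
  apply: kclass_ext => x; rewrite addr0.
  split=> [/hypersurface_openP[]|[x0 px]]; first by [].
  apply/hypersurface_openP; split=> //; apply: contra_neq px.
  by rewrite evM => ->; rewrite mulr0.
(* On f = 0 the condition t_i f + g <> 0 reads g <> 0, which leaves t_i free. *)
rewrite (@kclass_cylinder _ (lift ord0 i) (closed_part _ hF)); last 3 first.
- by [].
- by move=> x [[]].
- move=> x c [[x0 px] /vanish1]; rewrite ev_homogenize // => /eqP.
  rewrite mulf_eq0 expf_eq0 (negPf x0) andbF /= => /eqP fx.
  move: px; rewrite evD evM fx mulr0 add0r => gx.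
  split; first split; rewrite ?translate0 //.
    by rewrite affine_coords_translate evD evM (ev_indep _ _ fi)
      (ev_indep _ _ gi) fx mulr0 add0r.
  apply/vanish1; rewrite ev_homogenize ?translate0 // affine_coords_translate.
  by rewrite ev_indep // fx mulr0.
by eexists; rewrite addrC addKr.
Qed.

(** * Iteration over all variables *)

Lemma msupp_mderiv n i (p : {mpoly rat[n]}) m :
  m \in msupp p^`M(i) -> (m + U_(i))%MM \in msupp p.
Proof.
by rewrite !mcoeff_msupp mcoeff_deriv; apply: contra_neq => ->; rewrite mul0rn.
Qed.

(** As p has degree at most one in t_i, the coefficient f of t_i is the derivative of p, and g is
    the remainder p - t_i f. *)
Lemma kclass_mderiv n i (p : {mpoly rat[n]}) :
  (forall m, m \in msupp p -> (m i <= 1)%N) ->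
  eq_mod_ideal lefschetz (kclass (hypersurface_compl p))
                         (kclass (hypersurface_compl ('X_i * p^`M(i)))).
Proof.
move=> pi; rewrite -{1}[p](subrK ('X_i * p^`M(i))) addrC.
apply: kclass_multilinear => m.
  by move/msupp_mderiv/pi; rewrite mnmDE mnm1E eqxx addn1 ltnS leqn0 => /eqP.
(* A monomial m containing t_i cannot occur in the remainder: its coefficient in t_i f is m_i times
   that in p, and m_i = 1 whenever m lies in the support of p. *)
case mi : (m i) => [//|k]; rewrite mcoeff_msupp mcoeffB.
have {1 2}->: m = (U_(i) + (m - U_(i)))%MM.
  apply/mnmP=> j; rewrite mnmDE mnmBE mnm1E; have [<-|_] := eqVneq i j.
    by rewrite subnKC ?mi.
  by rewrite add0n subn0.
rewrite mulrC mcoeffMX mcoeff_deriv addmC.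
have [/pi|] := boolP (m - U_(i) + U_(i) \in msupp p)%MM.
  rewrite mnmDE mnm1E eqxx addn1 ltnS leqn0 => /eqP ->.
  by rewrite mulr1n subrr eqxx.
by rewrite -mcoeff_eq0 => /eqP ->; rewrite mul0rn subrr eqxx.
Qed.

(** Replacing q by t_i dq/dt_i discards the monomials without t_i. After all variables only t_1 ...
    t_n could be left, and p does not contain it; the polynomial reached is 0, whose complement is
    empty. *)
Lemma kclass_multilinear_eq0 n (p : {mpoly rat[n]}) :
  (forall m i, m \in msupp p -> (m i <= 1)%N) ->
  (forall m, m \in msupp p -> exists i, m i = 0%N) ->
  eq_mod_ideal lefschetz (kclass (hypersurface_compl p)) 0.
Proof.
move=> p1 p0.
(* Induction over the list of variables: those already treated have exponent 1 in every remaining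
   monomial. *)
have [q pq qp] : exists2 q : {mpoly rat[n]},
    eq_mod_ideal lefschetz (kclass (hypersurface_compl p))
                           (kclass (hypersurface_compl q)) &
    forall m, m \in msupp q ->
      m \in msupp p /\ forall i, i \in enum 'I_n -> m i = 1%N.
  elim: (enum 'I_n) => [|i s [q pq qp]].
    by exists p => [|m mp]; first exact: eq_mod_idealxx.
  exists ('X_i * q^`M(i)) => [|m].
    apply: eq_mod_ideal_trans pq _; apply: kclass_mderiv => m /qp[mp _].
    exact: p1.
  rewrite mulrC (perm_mem (msuppMX _ _)) => /mapP[m' /msupp_mderiv].
  rewrite addmC => /qp[mp ms] mE; rewrite mE; split=> // j.
  rewrite inE => /orP[/eqP ->|/ms//]; apply/eqP.
  by rewrite eqn_leq p1 // mnmDE mnm1E eqxx.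
apply: eq_mod_ideal_trans pq _.
rewrite (_ : kclass _ = 0); first exact: eq_mod_idealxx.
apply: kclass_empty => x [_].
suff ->: q = 0 by rewrite ev0 eqxx.
apply/msuppnil0; case: (msupp q) qp => // m s /(_ m (mem_head _ _))[/p0[i mi]].
by move/(_ i); rewrite mem_enum mi => /(_ isT).
Qed.

(** * The class of the torus *)

Lemma homogeneous_coords n (A : {set 'I_n}) :
  homogeneous [seq 'X_(lift ord0 j) : {mpoly rat[n.+1]} | j <- enum A].
Proof. by move=> p /mapP[j _ ->]; apply: homogX. Qed.

(** For disjoint A and B, this is a torus in the coordinates of B times an affine space in the
    coordinates outside A and B. *)
Definition stratum n (A B : {set 'I_n}) : qpvar n.+1 :=
  closed_part (hypersurface_compl (\prod_(j in B) 'X_j))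
    (@homogeneous_coords n A).

Lemma stratumP n (A B : {set 'I_n}) x :
  stratum A B x <->
  [/\ x 0 0 != 0, {in B, forall j, x 0 (lift ord0 j) != 0} &
      {in A, forall j, x 0 (lift ord0 j) = 0}].
Proof.
have evB : ev (\prod_(j in B) 'X_j) (affine_coords x) =
    \prod_(j in B) (x 0 (lift ord0 j) / x 0 0).
  rewrite /ev (rmorph_prod (mmap ratr (affine_coords x 0))).
  by apply: eq_bigr => j _; rewrite -[LHS]/(ev 'X_j (affine_coords x)) evX mxE.
split=> [[[x0]]|[x0 xB xA]].
  rewrite evB => /prodf_neq0 xB vA; split=> // j jS.
    by have := xB j jS; rewrite mulf_eq0 negb_or => /andP[].
  by rewrite -evX vA //; apply/mapP; exists j; rewrite ?mem_enum.
split; first split=> //.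
  by rewrite evB; apply/prodf_neq0 => j /xB xj; rewrite mulf_neq0 ?invr_eq0.
by move=> p /mapP[j]; rewrite mem_enum => /xA xj ->; rewrite evX.
Qed.

(** The coordinate i is free on [stratum A B], so this cylinder has class 0 mod L; cutting it by x_i
    = 0 yields the two strata compared here. *)
Lemma kclass_stratumU1 n i (A B : {set 'I_n}) : i \notin A -> i \notin B ->
  eq_mod_ideal lefschetz (kclass (stratum A (i |: B)))
                         (- kclass (stratum (i |: A) B)).
Proof.
move=> iA iB; have hX := homogeneous1 (homogX (lift ord0 i)).
have := kclass_parts (stratum A B) hX.
rewrite (@kclass_cylinder _ (lift ord0 i) (stratum A B)); last 3 first.
- by [].
- by move=> x /stratumP[].
- move=> x c /stratumP[x0 xB xA]; apply/stratumP.
  have xc j : j != i -> (x + c *: delta_mx 0 (lift ord0 i)) 0 (lift ord0 j) =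
      x 0 (lift ord0 j).
    by move=> ji; rewrite !mxE (inj_eq lift_inj) (negPf ji) andbF mulr0 addr0.
  split=> [|j jB|j jA]; first by rewrite translate0.
    by rewrite xc ?xB //; apply: contraNneq iB => <-.
  by rewrite xc ?xA //; apply: contraNneq iA => <-.
have ->: kclass (open_part (stratum A B) hX) = kclass (stratum A (i |: B)).
  apply: kclass_ext => x; split.
    move=> [/stratumP[x0 xB xA] /vanish1 xi]; apply/stratumP; split=> // j.
    by rewrite !inE => /orP[/eqP ->|/xB//]; apply/eqP => xi0; rewrite evX in xi.
  move=> /stratumP[x0 xB xA]; split.
    by apply/stratumP; split=> // j jB; apply: xB; rewrite !inE jB orbT.
  by move/vanish1/eqP; rewrite evX (negPf (xB i _)) // setU11.
have ->: kclass (closed_part (stratum A B) hX) = kclass (stratum (i |: A) B).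
  apply: kclass_ext => x; split.
    move=> [/stratumP[x0 xB xA] /vanish1 xi]; apply/stratumP; split=> // j.
    by rewrite !inE => /orP[/eqP ->|/xA//]; rewrite evX in xi.
  move=> /stratumP[x0 xB xA]; split.
    by apply/stratumP; split=> // j jA; apply: xA; rewrite !inE jA orbT.
  by apply/vanish1; rewrite evX xA // setU11.
by move=> SE; eexists; rewrite opprK -SE.
Qed.

(** This stratum is the single point (1 : 0 : ... : 0). *)
Lemma kclass_origin n : kclass (stratum setT (set0 : {set 'I_n})) = 1.
Proof.
rewrite -kclass_point.
pose h (j : 'I_1) : {mpoly rat[n.+1]} := 'X_ord0.
pose h' (j : 'I_n.+1) : {mpoly rat[1]} := if j == ord0 then 'X_ord0 else 0.
have hE x : \row_j ev (h j) x = (x 0 0)%:M.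
  by apply/rowP=> j; rewrite !mxE evX ord1 eqxx mulr1n.
have h'E y : \row_j ev (h' j) y = y 0 0 *: delta_mx 0 0.
  apply/rowP=> j; rewrite !mxE eqxx /h' /=.
  by case: eqP => _; rewrite ?evX ?mulr1 // ev0 mulr0.
have h'S y : affine_space 0 y -> stratum setT set0 (\row_j ev (h' j) y).
  move=> [y0 _]; apply/stratumP; rewrite h'E; split=> [|j|j _].
  - by rewrite !mxE mulr1.
  - by rewrite inE.
  - by rewrite !mxE /= mulr0.
apply: kclass_iso.
exists (fun x => \row_j ev (h j) x), (fun y => \row_j ev (h' j) y).
split.
- apply: (@morphism_forms _ _ _ _ 1%N) => [j|x /stratumP[x0 _ _]].
    exact: dhomogXi.
  by rewrite hE; split; rewrite ?mxE ?ev1 ?oner_neq0 // eqxx mulr1n.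
- apply: (@morphism_forms _ _ _ _ 1%N) => [j|y /h'S //].
  by rewrite /h'; case: ifP; rewrite ?dhomogXi ?rpred0.
- move=> x /stratumP[x0 _ xA]; rewrite hE h'E mxE eqxx mulr1n.
  rewrite (_ : _ *: _ = x); first exact: same_point_refl.
  apply/rowP=> j; rewrite !mxE eqxx /=; have [j' ->|->] := unliftP ord0 j.
    by rewrite mulr0 xA.
  by rewrite mulr1.
- move=> y [y0 _]; rewrite h'E hE mxE.
  rewrite (_ : _%:M = y); first exact: same_point_refl.
  by apply/rowP=> j; rewrite !mxE !ord1 !eqxx mulr1 mulr1n.
Qed.

Lemma kclass_torus n :
  eq_mod_ideal lefschetz (kclass (hypersurface_compl (\prod_(j < n) 'X_j)))
                         ((-1) ^+ n).
Proof.
(* The induction runs over all coordinate subtori, with the coordinates outside B equal to 0. Moving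
   i from B to its complement costs a sign, and the empty B leaves the origin. *)
have strat (B : {set 'I_n}) :
    eq_mod_ideal lefschetz (kclass (stratum (~: B) B)) ((-1) ^+ #|B|).
  elim: {B}#|B| {-2}B (erefl #|B|) => [|k IH] B Bk.
    move/eqP: Bk; rewrite cards_eq0 => /eqP ->.
    by rewrite setC0 kclass_origin cards0; apply: eq_mod_idealxx.
  have /card_gt0P[i iB] : (0 < #|B|)%N by rewrite Bk.
  have Ck : #|B :\ i| = k by move: Bk; rewrite (cardsD1 i) iB => -[].
  rewrite -{2 3}(setD1K iB); apply: eq_mod_ideal_trans.
    by apply: kclass_stratumU1; rewrite !inE ?iB // eqxx.
  rewrite setD1K // Bk exprS mulN1r; apply: eq_mod_idealN.
  have ->: i |: ~: B = ~: (B :\ i).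
    by apply/setP=> j; rewrite !inE negb_and negbK.
  by rewrite -Ck; apply: IH.
have := strat setT; rewrite setCT cardsT card_ord.
rewrite (@kclass_ext _ _ (hypersurface_compl (\prod_(j < n) 'X_j))) // => x.
have ->: \prod_(j < n) 'X_j = \prod_(j in [set: 'I_n]) 'X_j :> {mpoly rat[n]}.
  by apply: eq_bigl => j; rewrite inE.
by split=> [[]//|xS]; split=> // p /mapP[j]; rewrite mem_enum inE.
Qed.

(** * Monomials of the graph polynomial *)

Definition component (G : graph) (v : vertex G) : {set vertex G} :=
  [set w | connect (adjacent setT) v w].

Lemma connect_adjacent_sym (G : graph) (A : {set 'I_(nedges G)}) :
  connect_sym (adjacent A).
Proof.
apply: sym_connect_sym => u v; apply: eq_existsb => e.
by rewrite orbC [(src e == v) && _]andbC [(src e == u) && _]andbC.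
Qed.

Lemma component_eq (G : graph) (C : {set vertex G}) v :
  C \in components G -> v \in C -> C = component v.
Proof.
move=> /imsetP[u _ ->]; rewrite inE => uv; apply/setP=> w; rewrite !inE.
by rewrite (same_connect (connect_adjacent_sym _) uv w).
Qed.

Lemma component_in (G : graph) (v : vertex G) : component v \in components G.
Proof. exact: imset_f. Qed.

Lemma msupp_component_poly (G : graph) (C : {set vertex G}) m :
  m \in msupp (component_poly C) ->
  exists2 T, spanning_tree C T & forall e, m e = (e \in edges_of C :\: T).
Proof.
move=> /msupp_sum_le/flattenP[s /mapP[T]].
rewrite mem_filter => /andP[/asboolP CT _] ->.
have ->: \prod_(e in edges_of C :\: T) 'X_e =
    'X_[\sum_(e in edges_of C :\: T) U_(e)] :> {mpoly rat[nedges G]}.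
  exact: mprodXE.
move=> /mem_msuppXP <-; exists T => // e; rewrite mnm_sumE.
rewrite big_mkcond /= (bigD1 e) //= big1 => [|f fe]; last first.
  by rewrite mnm1E (negPf fe); case: ifP.
by rewrite mnm1E eqxx addn0; case: ifP.
Qed.

(** The edge e belongs to one component only, that of its source, and t_e has exponent at most 1 in
    the monomials of that factor. The predicate P covers both the full product and the product
    without one component. *)
Lemma msupp_prod_component_poly (G : graph) (P : pred {set vertex G})
    m e :
  m \in msupp (\prod_(C in components G | P C) component_poly C) ->
  (m e <= P (component (src e)))%N.
Proof.
(* The exponent of t_e is first bounded by the number of factors whose component contains the source
   of e. *)
suff mle : m \in msupp (\prod_(C in components G | P C) component_poly C) ->
    (m e <= \sum_(C in components G | P C) (src e \in C))%N.
  move=> /mle/leq_trans; apply; rewrite big_mkcondr /=.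
  rewrite (bigD1 (component (src e))) ?component_in //= big1 => [|C].
    by rewrite addn0; case: (P _); rewrite ?leq_b1.
  move=> /andP[Ci Ce]; have [eC|_] := boolP (src e \in C); last by case: (P C).
  by rewrite (component_eq Ci eC) eqxx in Ce.
elim/big_rec2: _ m => [|C k q _ IH] m.
  by rewrite msupp1 inE => /eqP ->; rewrite mnm0E.
move=> /msuppM_le/allpairsP[[m1 m2] /= [m1C m2q ->]].
rewrite mnmDE leq_add ?IH //.
have [T _ ->] := msupp_component_poly m1C.
by rewrite !inE; case: (e \in T).
Qed.

Lemma graph_poly_multilinear (G : graph) m e :
  m \in msupp (graph_poly G) -> (m e <= 1)%N.
Proof.
rewrite /graph_poly (eq_bigl (fun C => (C \in components G) && true)).
  by move=> /msupp_prod_component_poly ->.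
by move=> C; rewrite andbT.
Qed.

Lemma connect_adjacent0 (G : graph) (u v : vertex G) :
  connect (adjacent set0) u v -> u = v.
Proof.
by case/connectP=> -[|w p] //= /andP[/existsP[e]]; rewrite inE.
Qed.

(** A spanning tree T of the component of e has an edge f, since it joins the two distinct ends of
    e. Then t_f is absent from the monomial of T, and it occurs in no factor of another
    component. *)
Lemma graph_poly_nonloop (G : graph) m (e : 'I_(nedges G)) :
  ~~ looping_edge e ->
  m \in msupp (graph_poly G) -> exists i, m i = 0%N.
Proof.
move=> eG; rewrite /graph_poly (bigD1 (component (src e))) ?component_in //=.
move=> /msuppM_le/allpairsP[[m1 m2] /=].
move=> [/msupp_component_poly[T Tt m1E] m2C ->].
case: Tt => TC Tconn _.
have [T0|[f fT]] := set_0Vmem T.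
  case/eqP: eG; apply: connect_adjacent0; rewrite -T0; apply: Tconn.
    by rewrite inE connect0.
  rewrite inE connect1 //; apply/existsP; exists e.
  by rewrite inE !eqxx.
exists f; rewrite mnmDE m1E inE fT /=; apply/eqP; rewrite -leqn0.
have fC : src f \in component (src e) by have := subsetP TC _ fT; rewrite inE.
apply: leq_trans (msupp_prod_component_poly f m2C) _.
by rewrite -(component_eq (component_in _) fC) eqxx.
Qed.

(** Every component is a single vertex whose only spanning tree is empty, so its factor is the
    product of the variables of the loops at that vertex. *)
Lemma graph_poly_loops (G : graph) :
  (forall e : 'I_(nedges G), looping_edge e) ->
  graph_poly G = \prod_e 'X_e.
Proof.
move=> loops.
have compE (v : vertex G) : component v = [set v].
  apply/setP=> w; rewrite !inE; apply/idP/eqP => [|->]; last exact: connect0.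
  case/connectP=> p; elim: p v => [|u p IH] v /= => [_ -> //|].
  case/andP=> /existsP[e] /andP[_ vu] /IH up lw; rewrite up //.
  have /eqP eq_e := loops e.
  by move: vu; rewrite eq_e => /orP[] /andP[/eqP <- /eqP <-].
have treeE (v : vertex G) T : spanning_tree [set v] T <-> T = set0.
  split=> [[_ _ acyc]|->].
    (* A loop, travelled once, is a cycle of length one, so no edge can belong to T. *)
    apply/eqP; apply: contraPT acyc => /set0Pn[e eT] /(_ [:: (e, true)]).
    apply; last by move=> _ /[!inE] /eqP ->.
    by rewrite /is_cycle /= andbT /dtgt /dsrc /= eq_sym andbT; apply: loops.
  split; rewrite ?sub0set //.
    by move=> x y /set1P -> /set1P ->; apply: connect0.
  by move=> [|d c] // _ /(_ d.1 (mem_head _ _)); rewrite inE.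
have polyE (v : vertex G) :
    component_poly [set v] = \prod_(e | src e == v) 'X_e.
  rewrite /component_poly (big_pred1 set0) => [|T].
    by apply: eq_bigl => e; rewrite !inE.
  by apply/asboolP/eqP; case: (treeE v T).
rewrite /graph_poly /components (eq_imset _ compE) big_imset /=; last first.
  by move=> u v _ _ /set1_inj.
(* The product over all edges is grouped by source vertex, one group per component. *)
rewrite (partition_big (@src G) predT) //=.
by apply: eq_big => [v|v _]; rewrite ?polyE //.
Qed.

Theorem theorem3p2 (G : graph) :
  ((exists e : 'I_(nedges G), ~~ looping_edge e) ->
     eq_mod_ideal lefschetz (kclass (graph_compl G)) 0) /\
  ((forall e : 'I_(nedges G), looping_edge e) ->
     eq_mod_ideal lefschetz (kclass (graph_compl G)) ((-1) ^+ nedges G)).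
Proof.
split=> [[e eG]|loops].
  apply: kclass_multilinear_eq0 => m.
    by move=> i; apply: graph_poly_multilinear.
  exact: graph_poly_nonloop eG.
by rewrite /graph_compl graph_poly_loops //; apply: kclass_torus.
Qed.
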